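(* Let $q$ be a prime power, $g\ge1$, and let $f(x)=x^{2g}+a_1x^{2g-1}+\cdots+a_1q^{2g-2}x+q^{2g}\in\mathbb Z[x]$ be a Weil-$q^2$-polynomial. If $a_1>(2q-1)g$, then $f(-q)=0$.
   Context: A Weil-$q^2$-polynomial of degree $2g$ is a monic polynomial with integer coefficients all of whose complex roots have absolute value $q$, of the displayed form (i.e. with constant term $+q^{2g}$ and satisfying the symmetry that the coefficient of $x^{i}$ is $q^{2(g-i)}$ times the coefficient of $x^{2g-i}$). *)

(* Defs.v *)
From mathcomp Require Import all_boot all_order all_algebra.
From mathcomp Require Import reals complex.

Set Implicit Arguments.
Unset Strict Implicit.
Unset Printing Implicit Defensive.

Import Order.TTheory GRing.Theory Num.Theory.

Local Open Scope ring_scope.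
Local Open Scope complex_scope.

Definition prime_power (q : nat) : Prop :=
  exists p k : nat, [/\ prime p, (0 < k)%N & q = (p ^ k)%N].

(* The symmetry of the coefficients is required for i <= g only, where
   the natural number subtractions are exact; for g < i <= 2g it is the same
   relation read at 2g - i. *)
Record weil_poly (R : realType) (q g : nat) (f : {poly int}) : Prop := WeilPoly {
  weil_monic : f \is monic;
  weil_degree : size f = (2 * g).+1;
  weil_roots : forall z : R[i], root (map_poly intr f) z -> `|z| = q%:R;
  weil_constant : f`_0 = q%:Z ^+ (2 * g);
  weil_symmetry : forall i : nat, (i <= g)%N ->
    f`_i = q%:Z ^+ (2 * (g - i)) * f`_(2 * g - i)
}.

(* Main.v *)
Require Import Defs.
From mathcomp Require Import all_boot all_order all_algebra.
From mathcomp Require Import reals complex.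
From mathcomp Require Import ring zify.

Import Order.TTheory GRing.Theory Num.Theory.

Local Open Scope ring_scope.

(** Let z range over the 2g complex roots of f, with multiplicity.  Since
    |z| = q, each factor of f(-q) satisfies

      |q + z|^2 = (q + z)(q + z^* ) = q (2q + z + z^* )

    with 2q + z + z^* a nonnegative real; hence |f(-q)|^2 is q^(2g) times the
    product of these 2g reals, whose sum is 4qg - 2 a_1.

    On the other hand the symmetry of the coefficients forces q^g to divide
    the integer f(-q) ([dvdz_horner_symmetric]).  So if f(-q) is nonzero then
    |f(-q)| >= q^g, the product of the 2g reals is at least 1, and the
    inequality between the arithmetic and geometric means bounds their sum
    below by 2g ([size_le_sum_prod_ge1]).  This reads a_1 <= (2q - 1) g,
    against the hypothesis.

    Working with all 2g roots, rather than with the g numbers z + z^*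
    attached to conjugate pairs, avoids having to pair the roots up, and
    squaring |f(-q)| is what makes the two counts agree. *)

(** The inequality between the arithmetic and geometric means, in the form
    that bounds the trace of a totally positive algebraic integer below by its
    degree: the norm of such an integer is at least 1. *)
Lemma size_le_sum_prod_ge1 (F : numFieldType) (s : seq F) :
  {in s, forall x, 0 <= x} -> 1 <= \prod_(x <- s) x ->
  (size s)%:R <= \sum_(x <- s) x.
Proof.
case: (posnP (size s)) => [/size0nil -> _ _|s_gt0 s_ge0].
  by rewrite big_nil.
rewrite (big_tnth _ _ s) (big_tnth _ _ s) => prod_ge1.
have E_ge0 : {in [pred i : 'I_(size s) | true],
    forall i, 0 <= tnth (in_tuple s) i}.
  by move=> i _; apply: s_ge0; apply: mem_tnth.
have [+ _] := leif_AGM E_ge0; rewrite cardT size_enum_ord.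
set mu := _ / _ => /(le_trans prod_ge1) mu_ge1.
have mu_ge0 : 0 <= mu by rewrite divr_ge0 ?ler0n // sumr_ge0.
have := ler_pXn2r s_gt0 (rpred1 _) mu_ge0.
rewrite /= expr1n mu_ge1 => /esym.
by rewrite ler_pdivlMr ?ltr0n // mul1r.
Qed.

(** In a term f_i q^i of degree i < g, the missing powers of q are supplied
    by f_i itself, which carries the factor q^(2 (g - i)). *)
Lemma dvdz_horner_symmetric (q : int) (g : nat) (f : {poly int}) :
  (forall i, (i <= g)%N -> f`_i = q ^+ (2 * (g - i)) * f`_(2 * g - i)) ->
  (q ^+ g %| f.[- q])%Z.
Proof.
move=> f_sym; rewrite horner_coef; apply: rpred_sum => i _.
rewrite exprNn.
have [le_ig|/ltnW le_gi] := leqP i g; last first.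
  by rewrite !dvdz_mull // -(subnK le_gi) exprD dvdz_mull.
have -> : f`_i * ((-1) ^+ i * q ^+ i) =
    f`_(2 * g - i) * (-1) ^+ i * q ^+ (g - i) * (q ^+ (g - i) * q ^+ i).
  by rewrite f_sym // mul2n -addnn exprD; ring.
by rewrite -exprD subnK // dvdz_mull.
Qed.

Lemma normC_add_sqr (C : numClosedFieldType) (q : nat) (z : C) :
  `|z| = q%:R -> `|q%:R + z| ^+ 2 = q%:R * (q%:R *+ 2 + z + z^*).
Proof.
move=> z_q; have := normCK z; rewrite z_q normCK rmorphD /= rmorph_nat => zz.
rewrite mulrDl !mulrDr -zz; ring.
Qed.

(** Each 2q + z + z^* equals q^-1 |q + z|^2, hence is nonnegative, and the
    product of these numbers is q^(- size s) times the squared modulus assumed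
    to be large; the arithmetic-geometric inequality then applies. *)
Lemma size_le_sum_trace (C : numClosedFieldType) (q : nat) (s : seq C) :
  (0 < q)%N -> {in s, forall z, `|z| = q%:R} ->
  q%:R ^+ size s <= `|\prod_(z <- s) (- q%:R - z)| ^+ 2 ->
  (size s)%:R <= \sum_(z <- s) (q%:R *+ 2 + z + z^*).
Proof.
move=> q_gt0 s_q; have q_gt0C : 0 < q%:R :> C by rewrite ltr0n.
rewrite normr_prod -prodrXl => prod_ge.
rewrite -(big_map (fun z => q%:R *+ 2 + z + z^*) predT id) -(size_map
  (fun z => q%:R *+ 2 + z + z^*)).
apply: size_le_sum_prod_ge1 => [_ /mapP[z /s_q z_q ->]|].
  by rewrite -(pmulr_rge0 _ q_gt0C) -normC_add_sqr // exprn_ge0.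
rewrite big_map -(ler_pM2l (exprn_gt0 (size s) q_gt0C)) mulr1.
apply: le_trans prod_ge _.
rewrite -[in X in X * _](count_predT s) -iter_mulr_1 -big_const_seq.
rewrite -big_split /= big_seq [leRHS]big_seq.
by under eq_bigr => z /s_q z_q do rewrite -opprD normrN normC_add_sqr //.
Qed.

Theorem proposition1p6 (R : realType) (q g : nat) (f : {poly int})
    (hq : prime_power q) (hg : (1 <= g)%N) (hf : weil_poly R q g f)
    (ha1 : (2 * q%:Z - 1) * g%:Z < f`_(2 * g - 1)) :
  f.[- q%:Z] = 0.
Proof.
have q_gt0 : (0 < q)%N.
  by have [p [k [p_pr _ ->]]] := hq; rewrite expn_gt0 prime_gt0.
case: hf => f_monic f_size f_roots _ f_sym.
apply/eqP/negPn/negP => fq_neq0.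
(* The cofactor of q^g in f(-q) is a nonzero integer, so its square is >= 1. *)
have fq_ge : q%:Z ^+ (2 * g) <= f.[- q%:Z] ^+ 2.
  have /dvdzP[m fqE] := dvdz_horner_symmetric _ _ _ f_sym.
  have m_neq0 : m != 0 by apply: contraNneq fq_neq0 => m0; rewrite fqE m0 mul0r.
  rewrite fqE exprMn -exprM mulnC ler_peMl ?exprn_ge0 //.
  by rewrite -gtz0_ge1 exprn_even_gt0.
pose fC : {poly R[i]} := map_poly intr f.
have [s] := closed_field_poly_normal fC.
have -> : lead_coef fC = 1 by apply/monicP; apply: monic_map.
rewrite scale1r => fCE.
have s_size : size s = (2 * g)%N.
  apply: succn_inj; rewrite -f_size -(size_prod_XsubC s id) -fCE.
  by rewrite size_map_inj_poly //; apply: intr_inj.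
have s_norm : {in s, forall z, `|z| = q%:R}.
  by move=> z zs; apply: f_roots; rewrite -/fC fCE root_prod_XsubC.
have fqE : (f.[- q%:Z])%:~R = \prod_(z <- s) (- q%:R - z) :> R[i].
  rewrite -horner_map /= rmorphN /= -pmulrn -/fC fCE horner_prod.
  by apply: eq_bigr => z _; rewrite !hornerE.
have s_sum : \sum_(z <- s) z = - (f`_(2 * g - 1))%:~R.
  rewrite -[LHS]opprK -coefPn_prod_XsubC ?s_size -?fCE; last by lia.
  by rewrite coef_map subn1.
have fq_geC : q%:R ^+ size s <= `|\prod_(z <- s) (- q%:R - z)| ^+ 2.
  rewrite -fqE real_normK ?realz // (pmulrn _ q).
  by rewrite -!rmorphXn /= ler_int s_size rmorphXn.
have := size_le_sum_trace _ _ _ q_gt0 s_norm fq_geC.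
have s_conj_sum : \sum_(z <- s) z^* = - (f`_(2 * g - 1))%:~R.
  by rewrite -rmorph_sum /= s_sum rmorphN /= rmorph_int.
rewrite !big_split /= s_sum s_conj_sum big_const_seq count_predT iter_addr_0.
rewrite s_size -mulrnA !pmulrn -!rmorphN -!rmorphD /= ler_int.
set a1 := f`_(_) in ha1 *; nia.
Qed.
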